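(* Let $y=Xw^*+\epsilon$ with $X$ an $n\times d$ (random) feature matrix, $w^*\in\mathbb{R}^d$ the true parameter vector and $\epsilon$ an $n$-dimensional random error vector. Let $\gamma\in(0,1)$, let $P\in\mathbb{R}^{n\times n}$ be a row-stochastic matrix, let $D$ be the diagonal matrix carrying a stationary distribution of $P$ on its diagonal, and put $S=D(I-\gamma P)$, $A=X^\top SX$, $b=X^\top S y$. Suppose that $A$ is invertible, $\mathbb{E}[\epsilon\mid X]=0$ and $\operatorname{Cov}[\epsilon\mid X]=C$, and let $w_{TD}=A^{-1}b$. Then $\mathbb{E}[w_{TD}\mid X]=w^*$ and $$\operatorname{Cov}[w_{TD}\mid X]=A^{-1}X^\top S\,C\,S^\top X(A^{-1})^\top .$$ Moreover, if $S=S^\top$ (with $S$ invertible), then $w_{TD}$ is the best linear unbiased estimator (BLUE) of $w^*$ for problems with $C=c\cdot S^{-1}$, for every $c>0$.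
   Context: The $n$ training points are regarded as the states of a Markov reward process with transition matrix $P$ and discount $\gamma$; labels are regarded as state values, so the reward vector is $(I-\gamma P)y$ and $b=X^\top D(I-\gamma P)y$. The matrices $P$ and $D$ are treated as fixed given $X$. BLUE (conditionally on $X$): $w_{TD}$ is a linear function of $y$ with $\mathbb{E}[w_{TD}\mid X]=w^*$ for every value of $w^*$, and for every other estimator $\hat w=My$ (with $M$ depending only on $X,P,D,\gamma$) that is unbiased for every value of $w^*$, the matrix $\operatorname{Cov}[\hat w\mid X]-\operatorname{Cov}[w_{TD}\mid X]$ is positive semidefinite. *)

(* Defs.v *)
From HB Require Import structures.
From mathcomp Require Import all_boot all_order all_algebra.
From mathcomp Require Import all_classical all_reals all_analysis.

Set Implicit Arguments.
Unset Strict Implicit.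
Unset Printing Implicit Defensive.

Import Order.TTheory GRing.Theory Num.Theory.

Local Open Scope classical_set_scope.
Local Open Scope ring_scope.

Section random_matrices.
Context {disp : measure_display} {T : measurableType disp} {R : realType}.

Definition measurable_mx (m p : nat) (Y : T -> 'M[R]_(m, p)) : Prop :=
  forall i j, measurable_fun [set: T] (fun t => Y t i j).

(* The events {X_ij \in B}, B Borel; they generate the sigma-algebra sigma(X),
   which is [<<s sigma_gen X >>], the measurable sets of the type
   [g_sigma_algebraType (sigma_gen X)]. *)
Definition sigma_gen (n d : nat) (X : T -> 'M[R]_(n, d)) : set (set T) :=
  [set E | exists i j, exists2 B : set R,
     measurable B & E = (fun t => X t i j) @^-1` B].

(* Y is sigma(G)-measurable. For G = sigma_gen X this is how "depending only on
   X" is expressed. *)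
Definition adapted_mx (G : set (set T)) (m p : nat) (Y : T -> 'M[R]_(m, p)) :
    Prop :=
  forall i j, measurable_fun [set: g_sigma_algebraType G] (fun t => Y t i j).

Variable Pr : probability T R.

(* Z is a version of E[Y | sigma(G)]. The defining integral identity is required
   on the sigma(G)-events contained in some member of a sequence F k of
   sigma(G)-events increasing to the whole space, on each of which Y is
   integrable; F k = setT gives the case of an integrable Y. The localization
   (Y is "sigma-integrable with respect to sigma(G)") is equivalent to
   E[|Y| | sigma(G)] < +oo a.s., and it is needed because h(X) * Y may fail to be
   integrable when h is unbounded, although E[h(X) Y | X] = h(X) E[Y | X] makes
   sense. Versions are unique up to Pr-null sets. *)
Definition is_cond_exp (G : set (set T)) (Y Z : T -> R) : Prop :=
  measurable_fun [set: g_sigma_algebraType G] Z /\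
  exists F : (set T)^nat,
    [/\ forall k, G.-sigma.-measurable (F k),
        nondecreasing_seq F,
        \bigcup_k F k = [set: T],
        forall k, Pr.-integrable (F k) (fun t => (Y t)%:E) /\
                  Pr.-integrable (F k) (fun t => (Z t)%:E)
      & forall k (B : set T), G.-sigma.-measurable B -> B `<=` F k ->
          (\int[Pr]_(t in B) (Y t)%:E = \int[Pr]_(t in B) (Z t)%:E)%E].

Definition is_cond_exp_mx (G : set (set T)) (m p : nat)
    (Y Z : T -> 'M[R]_(m, p)) : Prop :=
  forall i j, is_cond_exp G (fun t => Y t i j) (fun t => Z t i j).

(* V is a version of Cov[Y | sigma(G)]. *)
Definition is_cond_cov (G : set (set T)) (m : nat)
    (Y : T -> 'cV[R]_m) (V : T -> 'M[R]_m) : Prop :=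
  exists2 mu : T -> 'cV[R]_m,
    is_cond_exp_mx G Y mu
    & is_cond_exp_mx G (fun t => (Y t - mu t) *m (Y t - mu t)^T) V.

Definition psd_mx (m : nat) (M : 'M[R]_m) : Prop :=
  M^T = M /\ forall v : 'cV[R]_m, 0 <= (v^T *m M *m v) 0 0.

Section linear_model.
Variables (n d : nat) (X : T -> 'M[R]_(n, d)) (eps : T -> 'cV[R]_n).

Definition labels (w : 'cV[R]_d) : T -> 'cV[R]_n := fun t => X t *m w + eps t.

(* An estimator maps the state t (through which it may use X) and the observed
   labels to an estimate of the parameter vector. *)
Definition is_linear_est (est : T -> 'cV[R]_n -> 'cV[R]_d) : Prop :=
  exists2 M : T -> 'M[R]_(d, n),
    adapted_mx (sigma_gen X) M & forall t y, est t y = M t *m y.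

Definition is_unbiased (est : T -> 'cV[R]_n -> 'cV[R]_d) : Prop :=
  forall w : 'cV[R]_d,
    is_cond_exp_mx (sigma_gen X) (fun t => est t (labels w t)) (fun=> w).

(* Conditional covariances being unique up to null sets, the versions V', V
   may be quantified existentially; this also asserts that they exist. *)
Definition is_BLUE (est : T -> 'cV[R]_n -> 'cV[R]_d) : Prop :=
  [/\ is_linear_est est, is_unbiased est
    & forall est', is_linear_est est' -> is_unbiased est' ->
      forall w : 'cV[R]_d, exists V' V : T -> 'M[R]_d,
      [/\ is_cond_cov (sigma_gen X) (fun t => est' t (labels w t)) V',
          is_cond_cov (sigma_gen X) (fun t => est t (labels w t)) V
        & {ae Pr, forall t, psd_mx (V' t - V t)}]].

End linear_model.

End random_matrices.

Section temporal_difference.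
Context {R : realType} (n d : nat).

Definition row_stochastic (P : 'M[R]_n) : Prop :=
  (forall i j, 0 <= P i j) /\ (forall i, \sum_j P i j = 1).

Definition stationary_dist (P : 'M[R]_n) (mu : 'rV[R]_n) : Prop :=
  [/\ forall i, 0 <= mu 0 i, \sum_i mu 0 i = 1 & mu *m P = mu].

Definition td_S (gamma : R) (P : 'M[R]_n) (mu : 'rV[R]_n) : 'M[R]_n :=
  diag_mx mu *m (1%:M - gamma *: P).

Definition td_A (X : 'M[R]_(n, d)) (S : 'M[R]_n) : 'M[R]_d := X^T *m S *m X.

Definition td_b (X : 'M[R]_(n, d)) (S : 'M[R]_n) (y : 'cV[R]_n) : 'cV[R]_d :=
  X^T *m S *m y.

Definition td_est (X : 'M[R]_(n, d)) (S : 'M[R]_n) (y : 'cV[R]_n) : 'cV[R]_d :=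
  invmx (td_A X S) *m td_b X S y.

End temporal_difference.

(* Main.v *)
(* Almost surely w_TD = w + H eps with H = A^-1 X^T S, so mean and covariance
   follow from pulling the sigma(X)-measurable H out of the conditional
   expectations. An unbiased M y satisfies M X = 1 almost surely, and with
   C = c S^-1 and S symmetric this gives (M - H) C H^T = 0, whence
   M C M^T - H C H^T = (M - H) C (M - H)^T. The latter is positive semidefinite
   because stationarity bounds sum_ij mu_i P_ij z_i z_j by sum_i mu_i z_i^2, so
   that the quadratic form of S is nonnegative. *)
Require Import Defs.
From HB Require Import structures.
From mathcomp Require Import all_boot all_order all_algebra.
From mathcomp Require Import all_classical all_reals all_analysis.
From mathcomp Require Import measurable_realfun ring lra.

Set Implicit Arguments.
Unset Strict Implicit.
Unset Printing Implicit Defensive.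

Import Order.TTheory GRing.Theory Num.Theory.

Local Open Scope classical_set_scope.
Local Open Scope ring_scope.

(** * Measurability of matrix operations, up to matrix inversion *)

Lemma measurable_invr (R : realType) : measurable_fun [set: R] (@GRing.inv R).
Proof.
(* Inversion is continuous only off 0, so the singleton of 0 is split off; on a singleton every
   function is measurable. *)
have -> : [set: R] = [set 0] `|` ~` [set 0] by rewrite setUv.
apply/measurable_funU => //; first exact: measurableC.
split; first exact: measurable_fun_set1.
apply: open_continuous_measurable_fun.
  exact/closed_openC/accessible_closed_set1/hausdorff_accessible/Rhausdorff.
move=> x; rewrite inE => /= /eqP x0; exact: inv_continuous.
Qed.

Section measurable_matrices.
Context {disp : measure_display} {T : measurableType disp} {R : realType}.

(** The measurable type is arbitrary in this section: over [g_sigma_algebraType G] these closure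
    properties become statements about [adapted_mx G]. *)
Lemma measurable_mx_cst (m p : nat) (M : 'M[R]_(m, p)) :
  measurable_mx (fun _ : T => M).
Proof. by move=> i j; exact: measurable_cst. Qed.

Lemma measurable_mxD (m p : nat) (M N : T -> 'M[R]_(m, p)) :
  measurable_mx M -> measurable_mx N -> measurable_mx (fun t => M t + N t).
Proof.
move=> mM mN i j; under eq_fun do rewrite mxE.
exact: measurable_funD.
Qed.

Lemma measurable_mxB (m p : nat) (M N : T -> 'M[R]_(m, p)) :
  measurable_mx M -> measurable_mx N -> measurable_mx (fun t => M t - N t).
Proof.
move=> mM mN i j; under eq_fun do rewrite !mxE.
exact: measurable_funB.
Qed.

Lemma measurable_mxZ (m p : nat) (a : R) (M : T -> 'M[R]_(m, p)) :
  measurable_mx M -> measurable_mx (fun t => a *: M t).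
Proof.
move=> mM i j; under eq_fun do rewrite mxE.
exact/measurable_funM.
Qed.

Lemma measurable_mxM (m p q : nat) (M : T -> 'M[R]_(m, p))
    (N : T -> 'M[R]_(p, q)) :
  measurable_mx M -> measurable_mx N -> measurable_mx (fun t => M t *m N t).
Proof.
move=> mM mN i j; under eq_fun do rewrite mxE.
by apply: measurable_sum => k; exact: measurable_funM.
Qed.

Lemma measurable_mx_tr (m p : nat) (M : T -> 'M[R]_(m, p)) :
  measurable_mx M -> measurable_mx (fun t => (M t)^T).
Proof. by move=> mM i j; under eq_fun do rewrite mxE; exact: mM. Qed.

Lemma measurable_diag_mx (m : nat) (v : T -> 'rV[R]_m) :
  measurable_mx v -> measurable_mx (fun t => diag_mx (v t)).
Proof.
move=> mv i j; under eq_fun do rewrite mxE.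
case: (i == j); first exact: mv.
exact: measurable_cst.
Qed.

Lemma measurable_det (m : nat) (M : T -> 'M[R]_m) :
  measurable_mx M -> measurable_fun [set: T] (fun t => \det (M t)).
Proof.
move=> mM; apply: measurable_sum => s; apply: measurable_funM => //.
by apply: measurable_prod => i _; exact: mM.
Qed.

Lemma measurable_invmx (m : nat) (M : T -> 'M[R]_m) :
  measurable_mx M -> measurable_mx (fun t => invmx (M t)).
Proof.
move=> mM i j; have mdet := measurable_det mM.
(* By convention [invmx] returns a singular matrix unchanged; on invertible ones it is the adjugate
   over the determinant. Both cases are needed to cover all of [T]. *)
rewrite (_ : (fun t => invmx (M t) i j) = (fun t =>
    if \det (M t) == 0 then M t i j
    else (\det (M t))^-1 * cofactor (M t) j i)); last first.
  apply/funext => t; rewrite /invmx unitmxE unitfE.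
  by case: eqP => //= _; rewrite !mxE.
apply: measurable_fun_ifT; last 2 first.
- exact: mM.
- apply: measurable_funM.
    exact: measurableT_comp (@measurable_invr R) mdet.
  apply: measurable_funM => //; apply: measurable_det => k l.
  by under eq_fun do rewrite !mxE; exact: mM.
- exact: measurable_fun_eqr.
Qed.

End measurable_matrices.

(** * Localized conditional expectations of real functions *)

Section conditional_expectation.
Context {disp : measure_display} {T : measurableType disp} {R : realType}.
Variables (Pr : probability T R) (G : set (set T)).
Hypothesis subG : G `<=` (measurable : set (set T)).

Local Notation Gmeas := (measurable_fun [set: g_sigma_algebraType G]).

Lemma sigma_measurable (B : set T) : G.-sigma.-measurable B -> measurable B.
Proof. exact: (smallest_sub (sigma_algebra_measurable T) subG). Qed.

Lemma sigma_measurable_fun (h : T -> R) : Gmeas h -> measurable_fun [set: T] h.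
Proof.
move=> mh _ Y mY; apply: sigma_measurable.
exact: (mh measurableT).
Qed.

Definition exhausting (F : (set T)^nat) :=
  [/\ forall k, G.-sigma.-measurable (F k), nondecreasing_seq F
    & \bigcup_k F k = [set: T]].

(** Two conditional expectations come with different localizing sequences; intersecting them gives a
    common one. *)
Lemma exhaustingI (F F' : (set T)^nat) :
  exhausting F -> exhausting F' -> exhausting (fun k => F k `&` F' k).
Proof.
move=> [mF ndF F1] [mF' ndF' F1']; split.
- by move=> k; exact: measurableI.
- by move=> i j ij; apply/subsetPset; apply: setISS; apply/subsetPset;
    [exact: ndF|exact: ndF'].
- apply/seteqP; split=> // t _.
  have : (\bigcup_k F k) t by rewrite F1.
  have : (\bigcup_k F' k) t by rewrite F1'.
  move=> [i _ Fi] [j _ Fj]; exists (maxn i j) => //; split.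
    by have /subsetPset := ndF _ _ (leq_maxr i j); exact.
  by have /subsetPset := ndF' _ _ (leq_maxl i j); exact.
Qed.

(** Truncation: on these events a possibly unbounded [h] is bounded, and they reach every point
    because [h] is real-valued. *)
Lemma exhausting_le (h : T -> R) : Gmeas h ->
  exhausting (fun k => [set t | `|h t| <= k%:R]).
Proof.
move=> mh; split.
- move=> k; rewrite -[X in measurable X]setTI.
  have := @measurable_fun_ler _ _ _ _ _ _
    (measurableT_comp (@normr_measurable R setT) mh) (measurable_cst (k%:R : R)).
  by move=> /(_ measurableT [set true]); exact.
- move=> i j ij; apply/subsetPset => t /= /le_trans; apply.
  by rewrite ler_nat.
- apply/seteqP; split=> // t _; exists (Num.trunc `|h t|).+1 => //=.
  by rewrite ltW// truncnS_gt.
Qed.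

Definition cond_exp_on (F : (set T)^nat) (Y Z : T -> R) :=
  forall k, [/\ Pr.-integrable (F k) (EFin \o Y), Pr.-integrable (F k) (EFin \o Z)
    & forall B, G.-sigma.-measurable B -> B `<=` F k ->
        \int[Pr]_(t in B) (Y t - Z t) = 0].

(** Integrability on [F k] makes both extended integrals finite, so their equality amounts to the
    vanishing of the real integral of [Y - Z], which is easier to manipulate. *)
Lemma is_cond_expP (Y Z : T -> R) : is_cond_exp Pr G Y Z <->
  Gmeas Z /\ exists2 F, exhausting F & cond_exp_on F Y Z.
Proof.
split=> [[mZ [F [mF ndF F1 iF eF]]]|[mZ [F [mF ndF F1] YZ]]]; split=> //.
  exists F => // k; have [iY iZ] := iF k; split=> // B mB BF.
  have mB' := sigma_measurable mB; have mF' := sigma_measurable (mF k).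
  rewrite RintegralB//; [|exact: integrableS iY|exact: integrableS iZ].
  by rewrite /Rintegral (eF k)// subrr.
exists F; split=> // [k|k B mB BF]; have [iY iZ eYZ] := YZ k; first by split.
have mB' := sigma_measurable mB; have mF' := sigma_measurable (mF k).
have iBY : Pr.-integrable B (EFin \o Y) by exact: integrableS iY.
have iBZ : Pr.-integrable B (EFin \o Z) by exact: integrableS iZ.
rewrite -[LHS]fineK; last exact: integrable_fin_num.
rewrite -[RHS]fineK; last exact: integrable_fin_num.
congr EFin; apply/eqP; rewrite -subr_eq0.
by rewrite -[_ - _](RintegralB mB' iBY iBZ) eYZ.
Qed.

Lemma cond_exp_onS (F F' : (set T)^nat) (Y Z : T -> R) :
  (forall k, G.-sigma.-measurable (F k)) ->
  (forall k, G.-sigma.-measurable (F' k)) -> (forall k, F' k `<=` F k) ->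
  cond_exp_on F Y Z -> cond_exp_on F' Y Z.
Proof.
move=> mF mF' sF YZ k; have [iY iZ eYZ] := YZ k.
have mFk := sigma_measurable (mF k); have mFk' := sigma_measurable (mF' k).
split; [exact: (integrableS mFk mFk' (sF k) iY)|
        exact: (integrableS mFk mFk' (sF k) iZ)|].
by move=> B mB BF'; apply: eYZ => //; exact: subset_trans (sF k).
Qed.

Lemma is_cond_expD (Y1 Z1 Y2 Z2 : T -> R) :
  is_cond_exp Pr G Y1 Z1 -> is_cond_exp Pr G Y2 Z2 ->
  is_cond_exp Pr G (fun t => Y1 t + Y2 t) (fun t => Z1 t + Z2 t).
Proof.
move=> /is_cond_expP[mZ1 [F1 xF1 YZ1]] /is_cond_expP[mZ2 [F2 xF2 YZ2]].
apply/is_cond_expP; split; first exact: measurable_funD.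
have xF := exhaustingI xF1 xF2.
exists (fun k => F1 k `&` F2 k) => // k.
have [mF1 _ _] := xF1; have [mF2 _ _] := xF2; have [mF _ _] := xF.
have mFk := sigma_measurable (mF k).
have [iY1 iZ1 e1] := cond_exp_onS mF1 mF (fun=> @subIsetl _ _ _) YZ1 k.
have [iY2 iZ2 e2] := cond_exp_onS mF2 mF (fun=> @subIsetr _ _ _) YZ2 k.
split; [exact: integrableD iY1 iY2|exact: integrableD iZ1 iZ2|].
move=> B mB BF; have mB' := sigma_measurable mB.
under eq_Rintegral do rewrite opprD addrACA.
have iW1 : Pr.-integrable B (EFin \o (Y1 \- Z1)).
  exact: (integrableS mFk mB' BF (integrableB mFk iY1 iZ1)).
have iW2 : Pr.-integrable B (EFin \o (Y2 \- Z2)).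
  exact: (integrableS mFk mB' BF (integrableB mFk iY2 iZ2)).
by rewrite (RintegralD mB' iW1 iW2) e1// e2// addr0.
Qed.

(** On each truncation set [Z] is bounded, hence integrable under the finite measure [Pr]. *)
Lemma is_cond_exp_id (Z : T -> R) : Gmeas Z -> is_cond_exp Pr G Z Z.
Proof.
move=> mZ; apply/is_cond_expP; split=> //.
have xF := exhausting_le mZ; have [mF _ _] := xF.
exists (fun k => [set t | `|Z t| <= k%:R]) => // k.
have mFk := sigma_measurable (mF k).
have iZ : Pr.-integrable [set t | `|Z t| <= k%:R] (EFin \o Z).
  apply: measurable_bounded_integrable => //.
  - by rewrite (le_lt_trans (probability_le1 Pr mFk))// ltry.
  - exact/measurable_funTS/sigma_measurable_fun.
  - exists k%:R; split=> //.
    by move=> M kM t /= /le_trans; apply; exact: ltW.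
split=> // B mB BF; under eq_Rintegral do rewrite subrr.
by rewrite Rintegral_cst ?mul0r//; exact: sigma_measurable.
Qed.

(** * Pulling a measurable factor out of a conditional expectation *)

Lemma integrable_bounded_mul (D : set T) (a : R) (h W : T -> R) :
  measurable D -> measurable_fun [set: T] h -> Pr.-integrable D (EFin \o W) ->
  (forall t, D t -> `|h t| <= a) -> Pr.-integrable D (EFin \o (h \* W)).
Proof.
move=> mD mh iW ha.
have mW : measurable_fun D W by apply/measurable_EFinP; exact: measurable_int iW.
apply: (le_integrable mD _ _ (integrableZl mD a iW)).
  apply/measurable_EFinP; apply: measurable_funM => //.
  exact: measurable_funTS mh.
move=> t Dt /=; rewrite lee_fin !normrM ler_wpM2r//.
by rewrite (le_trans (ha t Dt))// ler_norm.
Qed.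

(* Bisecting the range [a, a + l] of h: on a piece where h varies by l,
   |\int h W| = |\int (h - a) W| <= l \int |W|. *)
Lemma bisection_bound (W h : T -> R) (m : nat) : Gmeas h ->
  forall (B : set T) (a l : R), G.-sigma.-measurable B -> 0 <= l ->
  Pr.-integrable B (EFin \o W) ->
  (forall B', G.-sigma.-measurable B' -> B' `<=` B ->
     \int[Pr]_(t in B') W t = 0) ->
  (forall t, B t -> a <= h t <= a + l) ->
  2 ^+ m * `|\int[Pr]_(t in B) (h t * W t)| <= l * \int[Pr]_(t in B) `|W t|.
Proof.
move=> mh; have mh' := sigma_measurable_fun mh.
(* A range inside [[a, a + l]] bounds [|h|] by [|a| + |l|], so [h W] is integrable wherever [W]
   is. *)
have ihW (B : set T) (a l : R) : measurable B ->
    Pr.-integrable B (EFin \o W) -> (forall t, B t -> a <= h t <= a + l) ->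
    Pr.-integrable B (EFin \o (h \* W)).
  move=> mB iW hB; apply: (@integrable_bounded_mul _ (`|a| + `|l|)) => // t Bt.
  have /andP[ah hal] := hB t Bt.
  rewrite ler_norml; apply/andP; split.
    rewrite (le_trans _ ah)// lerNl -[leLHS]addr0 lerD//.
    by rewrite -normrN ler_norm.
  by rewrite (le_trans hal)// lerD// ler_norm.
elim: m => [|m IH] B a l mB l0 iW W0 hB; have mB' := sigma_measurable mB.
  have iaW : Pr.-integrable B (EFin \o (cst a \* W)).
    exact: (integrableZl mB' a iW).
  have ihWB := ihW _ _ _ mB' iW hB.
  have -> : \int[Pr]_(t in B) (h t * W t) =
      \int[Pr]_(t in B) ((h t - a) * W t).
    under [RHS]eq_Rintegral do rewrite mulrBl.
    by rewrite (RintegralB mB' ihWB iaW) RintegralZl// W0// mulr0 subr0.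
  have iW' : Pr.-integrable B (EFin \o (fun t => (h t - a) * W t)).
    have := integrableB mB' ihWB iaW.
    by apply: eq_integrable => // t _; rewrite /= mulrBl.
  rewrite expr0 mul1r (le_trans (le_normr_Rintegral mB' iW'))//.
  rewrite -RintegralZl//; last exact: integrable_norm.
  apply: le_Rintegral => //; first exact: integrable_norm.
    exact: (integrableZl mB' l (integrable_norm iW)).
  move=> t Bt; have /andP[ah hal] := hB t Bt.
  rewrite normrM ler_wpM2r// ger0_norm ?subr_ge0//.
  by rewrite lerBlDl.
(* [c] is the midpoint of the range. The two pieces are [sigma(G)]-events because [h] is
   [sigma(G)]-measurable, so the integral of [W] still vanishes on all their subevents. *)
pose c := a + l / 2.
pose B1 := B `&` [set t | h t <= c]; pose B2 := B `&` [set t | c < h t].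
have mB1 : G.-sigma.-measurable B1.
  apply: measurableI => //; rewrite -[X in measurable X]setTI.
  by apply: (@measurable_fun_ler _ _ _ _ _ _ mh (measurable_cst c) measurableT
    [set true]).
have mB2 : G.-sigma.-measurable B2.
  apply: measurableI => //; rewrite -[X in measurable X]setTI.
  by apply: (@measurable_fun_ltr _ _ _ _ _ _ (measurable_cst c) mh measurableT
    [set true]).
have mB1' := sigma_measurable mB1; have mB2' := sigma_measurable mB2.
have BE : B = B1 `|` B2.
  apply/seteqP; split=> [t Bt|t [][]//].
  by have [hc|hc] := leP (h t) c; [left|right].
have B12 : [disjoint B1 & B2].
  rewrite disj_set2E; apply/eqP/seteqP; split=> // t [[_ /= h1] [_ /=]].
  by rewrite ltNge h1.
have sB1 : B1 `<=` B by exact: subIsetl.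
have sB2 : B2 `<=` B by exact: subIsetl.
have l2 : 0 <= l / 2 by rewrite divr_ge0.
have le1 := IH B1 a (l / 2) mB1 l2 (integrableS mB' mB1' sB1 iW)
  (fun B' mB' BB' => W0 B' mB' (subset_trans BB' sB1)).
have le2 := IH B2 c (l / 2) mB2 l2 (integrableS mB' mB2' sB2 iW)
  (fun B' mB' BB' => W0 B' mB' (subset_trans BB' sB2)).
have -> : \int[Pr]_(t in B) (h t * W t) =
   \int[Pr]_(t in B1) (h t * W t) + \int[Pr]_(t in B2) (h t * W t).
  rewrite [in LHS]BE Rintegral_setU// -BE.
  exact: (ihW _ _ _ mB' iW hB).
have -> : \int[Pr]_(t in B) `|W t| =
   \int[Pr]_(t in B1) `|W t| + \int[Pr]_(t in B2) `|W t|.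
  by rewrite [in LHS]BE Rintegral_setU// -BE; exact: integrable_norm.
(* One factor 2 moves to the right and turns [l] into [l / 2], so that the two induction hypotheses
   add up to the claim. *)
rewrite exprSr -mulrA mulrCA -ler_pdivlMl// mulrA [2^-1 * l]mulrC mulrDr.
apply: le_trans (lerD (le1 _) (le2 _)).
- by rewrite -mulrDr ler_wpM2l ?exprn_ge0// ler_normD.
- by move=> t [Bt /= hc]; rewrite hc; have /andP[->] := hB t Bt.
- move=> t [Bt /= /ltW ->]; have /andP[_] := hB t Bt.
  by rewrite /c -addrA -splitr.
Qed.

(** On the truncation sets of [h], [bisection_bound] applies with [W = Y - Z] and any number [m] of
    bisections; letting [m] grow forces the integral of [h W] to vanish. *)
Lemma is_cond_expMl (h Y Z : T -> R) : Gmeas h -> is_cond_exp Pr G Y Z ->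
  is_cond_exp Pr G (fun t => h t * Y t) (fun t => h t * Z t).
Proof.
move=> mh /is_cond_expP[mZ [F xF YZ]].
apply/is_cond_expP; split; first exact: measurable_funM.
have xE := exhausting_le mh; have [mE _ _] := xE; have [mF _ _] := xF.
have xI := exhaustingI xF xE; have [mI _ _] := xI.
exists (fun k => F k `&` [set t | `|h t| <= k%:R]) => // k.
have mIk := sigma_measurable (mI k); have mh' := sigma_measurable_fun mh.
have [iY iZ eYZ] := cond_exp_onS mF mI (fun=> @subIsetl _ _ _) YZ k.
have hk t : (F k `&` [set t | `|h t| <= k%:R]) t -> `|h t| <= k%:R by case.
split; [exact: (integrable_bounded_mul mIk mh' iY hk)|
        exact: (integrable_bounded_mul mIk mh' iZ hk)|].
move=> B mB BI; have mB' := sigma_measurable mB.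
under eq_Rintegral do rewrite -mulrBr.
set q := (X in X = 0); apply/eqP; rewrite -normr_le0 leNgt; apply/negP => q0.
have iW : Pr.-integrable B (EFin \o (Y \- Z)).
  exact: (integrableS mIk mB' BI (integrableB mIk iY iZ)).
(* The range of [h] lies in [[-k, k]], of length [k + k]. The right-hand side is independent of [m],
   which is impossible for [q] nonzero since [2 ^+ m] is unbounded. *)
have bnd m : 2 ^+ m * `|q| <=
    (k%:R + k%:R) * \int[Pr]_(t in B) `|(Y \- Z) t|.
  apply: (@bisection_bound _ _ m mh B (- k%:R)) => //.
  - by move=> B' mB'' BB'; apply: eYZ => //; exact: subset_trans BI.
  - by move=> t /BI[_ /=]; rewrite addKr ler_norml.
have := bnd (Num.bound ((k%:R + k%:R) *
  (\int[Pr]_(t in B) `|(Y \- Z) t|) / `|q|)).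
by rewrite -ler_pdivlMr// leNgt upper_nthrootP.
Qed.

(** Pulling out [Z] itself makes [Z * Z] a conditional expectation of 0, so the integral of the
    square over each [F k] is 0. Countably many null sets then cover the whole space. *)
Lemma is_cond_exp0_ae (Z : T -> R) : is_cond_exp Pr G (fun=> 0) Z ->
  {ae Pr, forall t, Z t = 0}.
Proof.
move=> cZ; have [mZ _] := cZ; have mZ' := sigma_measurable_fun mZ.
have /is_cond_expP[_ [F [mF _ F1] ZZ]] := is_cond_expMl mZ cZ.
have Fk k : {ae Pr, forall t, F k t -> Z t = 0}.
  have mFk := sigma_measurable (mF k).
  have [_ iZZ /(_ _ (mF k) (@subset_refl _ _))] := ZZ k.
  under eq_Rintegral do rewrite mulr0 sub0r -mulN1r.
  rewrite RintegralZl// mulN1r => /eqP; rewrite oppr_eq0 => /eqP I0.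
  have mZZ : measurable_fun (F k) (EFin \o (Z \* Z)).
    apply/measurable_EFinP/measurable_funM; exact: measurable_funTS.
  have /(ae_eq_integral_abs Pr mFk mZZ) :
      (\int[Pr]_(t in F k) `|(EFin \o (Z \* Z)%R) t| = 0)%E.
    have -> : (\int[Pr]_(t in F k) `|(EFin \o (Z \* Z)%R) t|)%E =
        (\int[Pr]_(t in F k) (Z t * Z t)%R%:E)%E.
      by apply: eq_integral => t _ /=; rewrite ger0_norm// -expr2 sqr_ge0.
    by rewrite -[LHS]fineK ?[fine _]I0//; exact: (integrable_fin_num mFk iZZ).
  apply: filterS => t /= /[apply] -[] /eqP.
  by rewrite mulf_eq0 orbb => /eqP.
have := @ae_foralln _ _ _ Pr (fun k t => F k t -> Z t = 0) Fk.
apply: filterS => t Ft; have : (\bigcup_k F k) t by rewrite F1.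
by move=> [k _ /Ft].
Qed.

Lemma is_cond_expB (Y1 Z1 Y2 Z2 : T -> R) :
  is_cond_exp Pr G Y1 Z1 -> is_cond_exp Pr G Y2 Z2 ->
  is_cond_exp Pr G (fun t => Y1 t - Y2 t) (fun t => Z1 t - Z2 t).
Proof.
move=> c1 c2; have mN1 : Gmeas (cst (-1 : R)) by exact: measurable_cst.
have := is_cond_expD c1 (is_cond_expMl mN1 c2).
by congr is_cond_exp; apply/funext => t; rewrite mulN1r.
Qed.

(** The difference of two versions is a conditional expectation of 0. *)
Lemma is_cond_exp_unique (Y Z1 Z2 : T -> R) :
  is_cond_exp Pr G Y Z1 -> is_cond_exp Pr G Y Z2 ->
  {ae Pr, forall t, Z1 t = Z2 t}.
Proof.
move=> c1 c2; have := is_cond_expB c1 c2.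
rewrite (_ : (fun t => Y t - Y t) = fun=> 0); last first.
  by apply/funext => t; rewrite subrr.
move=> /is_cond_exp0_ae; apply: filterS => t /eqP.
by rewrite subr_eq0 => /eqP.
Qed.

Lemma integrable_ae_eq (D : set T) (f g : T -> R) : measurable D ->
  measurable_fun D g -> {ae Pr, forall t, f t = g t} ->
  Pr.-integrable D (EFin \o f) -> Pr.-integrable D (EFin \o g).
Proof.
move=> mD mg fg /integrableP[mf fi]; apply/integrableP.
have mg' : measurable_fun D (EFin \o g) by exact/measurable_EFinP.
split=> //; rewrite (ae_eq_integral (abse \o (EFin \o f)))//.
- exact: measurableT_comp.
- exact: measurableT_comp.
- by apply: filterS fg => t /= ->.
Qed.

(** Measurability of [Y'] and [Z'] is required separately because a change on a null set need not
    preserve it. *)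
Lemma is_cond_exp_ae (Y Y' Z Z' : T -> R) :
  measurable_fun [set: T] Y' -> Gmeas Z' ->
  {ae Pr, forall t, Y t = Y' t} -> {ae Pr, forall t, Z t = Z' t} ->
  is_cond_exp Pr G Y Z -> is_cond_exp Pr G Y' Z'.
Proof.
move=> mY' mZ' YY' ZZ' /is_cond_expP[mZ [F xF YZ]].
apply/is_cond_expP; split=> //; exists F => // k.
have [mF _ _] := xF; have mFk := sigma_measurable (mF k).
have mZ'' := sigma_measurable_fun mZ'.
have [iY iZ eYZ] := YZ k.
have iY' : Pr.-integrable (F k) (EFin \o Y').
  by apply: integrable_ae_eq YY' iY => //; exact: measurable_funTS.
have iZ' : Pr.-integrable (F k) (EFin \o Z').
  by apply: integrable_ae_eq ZZ' iZ => //; exact: measurable_funTS.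
split=> // B mB BF; have mB' := sigma_measurable mB.
rewrite -(eYZ B mB BF) /Rintegral; congr fine.
have iW : Pr.-integrable B (EFin \o (Y \- Z)).
  exact: (integrableS mFk mB' BF (integrableB mFk iY iZ)).
have iW' : Pr.-integrable B (EFin \o (Y' \- Z')).
  exact: (integrableS mFk mB' BF (integrableB mFk iY' iZ')).
apply: ae_eq_integral => //.
- exact: measurable_int iW'.
- exact: measurable_int iW.
- by apply: filterS2 YY' ZZ' => t -> ->.
Qed.

(** * Entrywise passage to matrix-valued conditional expectations *)

Lemma is_cond_exp_sum (I : Type) (s : seq I) (Y Z : I -> T -> R) :
  (forall i, is_cond_exp Pr G (Y i) (Z i)) ->
  is_cond_exp Pr G (fun t => \sum_(i <- s) Y i t)
    (fun t => \sum_(i <- s) Z i t).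
Proof.
move=> YZ; elim: s => [|i s IH].
  under eq_fun do rewrite big_nil; under [X in is_cond_exp _ _ _ X]eq_fun do
    rewrite big_nil.
  exact/is_cond_exp_id/measurable_cst.
under eq_fun do rewrite big_cons; under [X in is_cond_exp _ _ _ X]eq_fun do
  rewrite big_cons.
exact: is_cond_expD.
Qed.

Lemma is_cond_exp_mulmxl (m p q : nat) (M : T -> 'M[R]_(m, p))
    (Y Z : T -> 'M[R]_(p, q)) :
  adapted_mx G M -> is_cond_exp_mx Pr G Y Z ->
  is_cond_exp_mx Pr G (fun t => M t *m Y t) (fun t => M t *m Z t).
Proof.
move=> mM YZ i j.
under eq_fun do rewrite mxE; under [X in is_cond_exp _ _ _ X]eq_fun do
  rewrite mxE.
by apply: is_cond_exp_sum => k; exact: is_cond_expMl.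
Qed.

Lemma is_cond_exp_mulmxr (m p q : nat) (M : T -> 'M[R]_(p, q))
    (Y Z : T -> 'M[R]_(m, p)) :
  adapted_mx G M -> is_cond_exp_mx Pr G Y Z ->
  is_cond_exp_mx Pr G (fun t => Y t *m M t) (fun t => Z t *m M t).
Proof.
move=> mM YZ i j.
under eq_fun do rewrite mxE; under [X in is_cond_exp _ _ _ X]eq_fun do
  rewrite mxE.
apply: is_cond_exp_sum => k.
under eq_fun do rewrite mulrC; under [X in is_cond_exp _ _ _ X]eq_fun do
  rewrite mulrC.
exact: is_cond_expMl.
Qed.

Lemma is_cond_expD_mx (m p : nat) (Y1 Z1 Y2 Z2 : T -> 'M[R]_(m, p)) :
  is_cond_exp_mx Pr G Y1 Z1 -> is_cond_exp_mx Pr G Y2 Z2 ->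
  is_cond_exp_mx Pr G (fun t => Y1 t + Y2 t) (fun t => Z1 t + Z2 t).
Proof.
move=> c1 c2 i j.
under eq_fun do rewrite mxE; under [X in is_cond_exp _ _ _ X]eq_fun do
  rewrite mxE.
exact: is_cond_expD.
Qed.

Lemma is_cond_expB_mx (m p : nat) (Y1 Z1 Y2 Z2 : T -> 'M[R]_(m, p)) :
  is_cond_exp_mx Pr G Y1 Z1 -> is_cond_exp_mx Pr G Y2 Z2 ->
  is_cond_exp_mx Pr G (fun t => Y1 t - Y2 t) (fun t => Z1 t - Z2 t).
Proof.
move=> c1 c2 i j.
under eq_fun do rewrite !mxE; under [X in is_cond_exp _ _ _ X]eq_fun do
  rewrite !mxE.
exact: is_cond_expB.
Qed.

Lemma is_cond_exp_mx_id (m p : nat) (Z : T -> 'M[R]_(m, p)) :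
  adapted_mx G Z -> is_cond_exp_mx Pr G Z Z.
Proof. by move=> mZ i j; exact: is_cond_exp_id. Qed.

Lemma is_cond_exp_mx_ae (m p : nat) (Y Y' Z Z' : T -> 'M[R]_(m, p)) :
  measurable_mx Y' -> adapted_mx G Z' ->
  {ae Pr, forall t, Y t = Y' t} -> {ae Pr, forall t, Z t = Z' t} ->
  is_cond_exp_mx Pr G Y Z -> is_cond_exp_mx Pr G Y' Z'.
Proof.
move=> mY' mZ' YY' ZZ' YZ i j; apply: is_cond_exp_ae (YZ i j) => //.
- by apply: filterS YY' => t ->.
- by apply: filterS ZZ' => t ->.
Qed.

Lemma ae_eq_mx (m p : nat) (Z1 Z2 : T -> 'M[R]_(m, p)) :
  (forall i j, {ae Pr, forall t, Z1 t i j = Z2 t i j}) ->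
  {ae Pr, forall t, Z1 t = Z2 t}.
Proof.
move=> Z12; have : {ae Pr, forall t, forall i j, Z1 t i j = Z2 t i j}.
  by apply: filter_forall => i; apply: filter_forall => j; exact: Z12.
by apply: filterS => t Zt; apply/matrixP.
Qed.

Lemma is_cond_exp_mx_unique (m p : nat) (Y Z1 Z2 : T -> 'M[R]_(m, p)) :
  is_cond_exp_mx Pr G Y Z1 -> is_cond_exp_mx Pr G Y Z2 ->
  {ae Pr, forall t, Z1 t = Z2 t}.
Proof.
move=> c1 c2; apply: ae_eq_mx => i j.
exact: is_cond_exp_unique (c1 i j) (c2 i j).
Qed.

Lemma measurable_adapted_mx (m p : nat) (Z : T -> 'M[R]_(m, p)) :
  adapted_mx G Z -> measurable_mx Z.
Proof. by move=> mZ i j; exact: sigma_measurable_fun. Qed.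

End conditional_expectation.

(** * Mean and covariance of estimators affine in a centered error *)

Section linear_estimators.
Context {disp : measure_display} {T : measurableType disp} {R : realType}.
Variables (Pr : probability T R) (G : set (set T)).
Hypothesis subG : G `<=` (measurable : set (set T)).
Variables (n d : nat) (eps : T -> 'cV[R]_n).
Hypothesis eps_meas : measurable_mx eps.
Hypothesis eps_mean : is_cond_exp_mx Pr G eps (fun=> 0).

(** The affine form is required only almost surely: for the estimators considered it rests on a left
    inverse of [X] that exists off a null set. *)
Lemma is_cond_exp_affine (K : T -> 'M[R]_(d, n)) (Y : T -> 'cV[R]_d)
    (w : 'cV[R]_d) :
  adapted_mx G K -> measurable_mx Y ->
  {ae Pr, forall t, Y t = w + K t *m eps t} ->
  is_cond_exp_mx Pr G Y (fun=> w).
Proof.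
move=> aK mY YE.
have aw : adapted_mx G (fun=> w) by exact: measurable_mx_cst.
have := is_cond_expD_mx subG (is_cond_exp_mx_id Pr subG aw)
  (is_cond_exp_mulmxl subG aK eps_mean).
apply: is_cond_exp_mx_ae => //; first by apply: filterS YE => t ->.
by apply: aeW => t; rewrite mulmx0 addr0.
Qed.

(** [is_cond_cov] leaves the version of the mean existential; by uniqueness it vanishes almost
    surely, so [C] is the conditional second moment. *)
Lemma is_cond_cov_centered (C : T -> 'M[R]_n) : is_cond_cov Pr G eps C ->
  is_cond_exp_mx Pr G (fun t => eps t *m (eps t)^T) C.
Proof.
move=> [nu /(is_cond_exp_mx_unique subG eps_mean) nu0 cC].
have aC : adapted_mx G C by move=> i j; have [] := cC i j.
apply: is_cond_exp_mx_ae cC => //.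
- exact/measurable_mxM/measurable_mx_tr.
- by apply: filterS nu0 => t <-; rewrite subr0.
- exact: aeW.
Qed.

(** The conditional mean is [w], so the centered vector is [K eps]; the adapted factors [K] and
    [K^T] are pulled out on the left and on the right. *)
Lemma is_cond_cov_affine (C : T -> 'M[R]_n) (K : T -> 'M[R]_(d, n))
    (Y : T -> 'cV[R]_d) (w : 'cV[R]_d) :
  is_cond_cov Pr G eps C -> adapted_mx G K -> measurable_mx Y ->
  {ae Pr, forall t, Y t = w + K t *m eps t} ->
  is_cond_cov Pr G Y (fun t => K t *m C t *m (K t)^T).
Proof.
move=> /is_cond_cov_centered cC aK mY YE.
exists (fun=> w); first exact: is_cond_exp_affine YE.
have aKT : adapted_mx G (fun t => (K t)^T) by exact: measurable_mx_tr.
have cKCK := is_cond_exp_mulmxr subG aKT (is_cond_exp_mulmxl subG aK cC).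
apply: is_cond_exp_mx_ae cKCK => //.
- have mYw : measurable_mx (fun t => Y t - w).
    exact: measurable_mxB (measurable_mx_cst _).
  exact/measurable_mxM/measurable_mx_tr.
- apply: measurable_mxM => //; apply: measurable_mxM => // i j.
  by have [] := cC i j.
- by apply: filterS YE => t ->; rewrite [w + _]addrC addrK trmx_mul !mulmxA.
- exact: aeW.
Qed.

(** Subtracting the mean-zero part [M eps] shows that [w] is a conditional expectation of [M X w].
    Being adapted, [M X w] is also its own, and uniqueness identifies the two. *)
Lemma unbiased_left_inverse (X : T -> 'M[R]_(n, d)) (M : T -> 'M[R]_(d, n)) :
  adapted_mx G X -> adapted_mx G M ->
  (forall w, is_cond_exp_mx Pr G (fun t => M t *m labels X eps w t) (fun=> w)) ->
  {ae Pr, forall t, M t *m X t = 1%:M}.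
Proof.
move=> aX aM unbM.
have MXw (w : 'cV[R]_d) : {ae Pr, forall t, M t *m X t *m w = w}.
  have aMXw : adapted_mx G (fun t => M t *m X t *m w).
    by do 2 apply: measurable_mxM => //; exact: measurable_mx_cst.
  apply: (is_cond_exp_mx_unique subG (is_cond_exp_mx_id Pr subG aMXw)).
  have := is_cond_expB_mx subG (unbM w) (is_cond_exp_mulmxl subG aM eps_mean).
  congr is_cond_exp_mx; apply/funext => t.
    by rewrite /labels mulmxDr addrK mulmxA.
  by rewrite mulmx0 subr0.
(* The exceptional null set depends on [w], so only the finitely many basis vectors are used; they
   recover the columns of [M X]. *)
apply: ae_eq_mx => i j; apply: filterS (MXw (delta_mx j 0)) => t.
by rewrite -colE => /colP /(_ i); rewrite !mxE eqxx andbT.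
Qed.

End linear_estimators.

(** * The sigma-algebra generated by the features *)

Lemma sigma_gen_measurable (disp : measure_display) (T : measurableType disp)
    (R : realType) (n d : nat) (X : T -> 'M[R]_(n, d)) :
  measurable_mx X -> sigma_gen X `<=` (measurable : set (set T)).
Proof.
move=> mX E [i [j [B mB ->]]]; rewrite -[X in measurable X]setTI.
exact: mX.
Qed.

Lemma adapted_sigma_gen (disp : measure_display) (T : measurableType disp)
    (R : realType) (n d : nat) (X : T -> 'M[R]_(n, d)) :
  adapted_mx (sigma_gen X) X.
Proof.
by move=> i j _ B mB; rewrite setTI; apply: sub_sigma_algebra; exists i, j, B.
Qed.

(** * Positivity of the form of [S] and comparison of covariances *)

Section quadratic_forms.
Context {R : realType} (n : nat).

Lemma quadratic_formE (M : 'M[R]_n) (z : 'cV[R]_n) :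
  (z^T *m M *m z) 0 0 = \sum_i \sum_j M i j * (z i 0 * z j 0).
Proof.
rewrite mxE exchange_big /=; apply: eq_bigr => j _.
rewrite !mxE mulr_suml; apply: eq_bigr => i _.
by rewrite mxE mulrAC mulrC.
Qed.

(* \sum_ij mu_i P_ij (z_i - z_j)^2 >= 0, where stationarity makes mu both
   marginals of the weights mu_i P_ij. *)
Lemma stationary_quadratic_form (P : 'M[R]_n) (mu : 'rV[R]_n) (z : 'cV[R]_n) :
  row_stochastic P -> stationary_dist P mu ->
  \sum_i \sum_j mu 0 i * P i j * (z i 0 * z j 0) <= \sum_i mu 0 i * z i 0 ^+ 2.
Proof.
move=> [P0 P1] [mu0 _ muP].
have rows : \sum_i \sum_j mu 0 i * P i j * z i 0 ^+ 2 =
    \sum_i mu 0 i * z i 0 ^+ 2.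
  by apply: eq_bigr => i _; rewrite -mulr_suml -mulr_sumr P1 mulr1.
have cols : \sum_i \sum_j mu 0 i * P i j * z j 0 ^+ 2 =
    \sum_i mu 0 i * z i 0 ^+ 2.
  rewrite exchange_big; apply: eq_bigr => j _; rewrite -mulr_suml.
  by rewrite -[in RHS]muP mxE.
have : 0 <= \sum_i \sum_j mu 0 i * P i j * (z i 0 - z j 0) ^+ 2.
  by do 2 (apply: sumr_ge0 => ? _); rewrite mulr_ge0 ?sqr_ge0// mulr_ge0.
have -> : \sum_i \sum_j mu 0 i * P i j * (z i 0 - z j 0) ^+ 2 =
    \sum_i \sum_j mu 0 i * P i j * z i 0 ^+ 2
    + \sum_i \sum_j mu 0 i * P i j * z j 0 ^+ 2
    - 2 * \sum_i \sum_j mu 0 i * P i j * (z i 0 * z j 0).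
  rewrite mulr_sumr -big_split -sumrB; apply: eq_bigr => i _ /=.
  rewrite mulr_sumr -big_split -sumrB; apply: eq_bigr => j _ /=.
  by ring.
by rewrite rows cols; lra.
Qed.

(** The form is [N - gamma Q] with [N] the [mu]-weighted sum of squares. Stationarity gives
    [Q <= N], hence [gamma Q <= gamma N <= N], as [gamma] lies in (0, 1) and [N] is nonnegative. *)
Lemma td_S_quadratic_form_ge0 (gamma : R) (P : 'M[R]_n) (mu : 'rV[R]_n)
    (z : 'cV[R]_n) :
  0 < gamma -> gamma < 1 -> row_stochastic P -> stationary_dist P mu ->
  0 <= (z^T *m td_S gamma P mu *m z) 0 0.
Proof.
move=> g0 g1 stP stmu.
have N0 : 0 <= \sum_i mu 0 i * z i 0 ^+ 2.
  by have [mu0 _ _] := stmu; apply: sumr_ge0 => i _; rewrite mulr_ge0 ?sqr_ge0.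
have -> : (z^T *m td_S gamma P mu *m z) 0 0 = \sum_i mu 0 i * z i 0 ^+ 2
    - gamma * \sum_i \sum_j mu 0 i * P i j * (z i 0 * z j 0).
  rewrite quadratic_formE mulr_sumr -sumrB; apply: eq_bigr => i _.
  (* The index [j = i] is isolated, being the only one where the identity matrix in [S]
     contributes. *)
  rewrite mulr_sumr (bigD1 i)//= [in RHS](bigD1 i)//= opprD addrA -sumrN.
  rewrite /td_S mul_diag_mx; congr (_ + _).
    by rewrite !mxE eqxx mulr1n; ring.
  apply: eq_bigr => j ji; rewrite !mxE eq_sym (negbTE ji) mulr0n; ring.
have := stationary_quadratic_form z stP stmu; nra.
Qed.

(** Substituting [z = S^-1 v] turns the form of [S] at [z] into the form of [S^-1] at [v], by
    symmetry of [S]. *)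
Lemma psd_mx_scale_inv (S : 'M[R]_n) (c : R) : 0 < c -> S^T = S ->
  S \in unitmx -> (forall z : 'cV[R]_n, 0 <= (z^T *m S *m z) 0 0) ->
  psd_mx (c *: invmx S).
Proof.
move=> c0 symS uS S0; split=> [|v].
  by rewrite linearZ /= trmx_inv symS.
rewrite -scalemxAr -scalemxAl mxE mulr_ge0 ?(ltW c0)//.
have := S0 (invmx S *m v).
by rewrite trmx_mul trmx_inv symS -!mulmxA mulKVmx.
Qed.

Lemma psd_mx_conj (d : nat) (K : 'M[R]_(d, n)) (C : 'M[R]_n) :
  psd_mx C -> psd_mx (K *m C *m K^T).
Proof.
move=> [symC C0]; split=> [|v]; first by rewrite !trmx_mul trmxK symC mulmxA.
by have := C0 (K^T *m v); rewrite trmx_mul trmxK !mulmxA.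
Qed.

Lemma td_left_inverse (d : nat) (X : 'M[R]_(n, d)) (S : 'M[R]_n) :
  td_A X S \in unitmx -> invmx (td_A X S) *m X^T *m S *m X = 1%:M.
Proof. by move=> uA; rewrite -!mulmxA (mulmxA X^T); exact: mulVmx. Qed.

(** A Pythagorean identity. [C] cancels the [S] in [H], so [H C = c A^-1 X^T]; since [K = M - H]
    satisfies [K X = 0], both cross terms vanish when [M = H + K] is expanded. *)
Lemma td_covariance_gap (d : nat) (X : 'M[R]_(n, d)) (S : 'M[R]_n)
    (M : 'M[R]_(d, n)) (c : R) :
  S^T = S -> S \in unitmx -> td_A X S \in unitmx -> M *m X = 1%:M ->
  let H := invmx (td_A X S) *m X^T *m S in
  let C := c *: invmx S in
  M *m C *m M^T - H *m C *m H^T = (M - H) *m C *m (M - H)^T.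
Proof.
move=> symS uS uA MX H C.
have [K KE] : exists K, K = M - H by exists (M - H).
have HX : H *m X = 1%:M by exact: td_left_inverse.
have KX : K *m X = 0 by rewrite KE mulmxBl MX HX subrr.
have symC : C^T = C by rewrite linearZ /= trmx_inv symS.
have HCK : H *m C *m K^T = 0.
  rewrite -scalemxAr mulmxK// -scalemxAl -mulmxA -trmx_mul KX trmx0 mulmx0.
  by rewrite scaler0.
have KCH : K *m C *m H^T = 0.
  by apply: trmx_inj; rewrite trmx_mul trmxK trmx_mul symC mulmxA HCK trmx0.
rewrite -KE (_ : M = H + K); last by rewrite KE addrC subrK.
rewrite [(H + K)^T]linearD /= !mulmxDl !mulmxDr HCK KCH addr0 add0r.
by rewrite addrC addKr.
Qed.

End quadratic_forms.

Theorem proposition4p2 (R : realType) (disp : measure_display)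
    (T : measurableType disp) (Pr : probability T R) (n d : nat)
    (X : T -> 'M[R]_(n, d)) (wstar : 'cV[R]_d) (eps : T -> 'cV[R]_n)
    (gamma : R) (P : T -> 'M[R]_n) (mu : T -> 'rV[R]_n) (C : T -> 'M[R]_n)
    (X_meas : measurable_mx X) (eps_meas : measurable_mx eps)
    (gamma_gt0 : 0 < gamma) (gamma_lt1 : gamma < 1)
    (P_adapted : adapted_mx (sigma_gen X) P)
    (mu_adapted : adapted_mx (sigma_gen X) mu)
    (P_stochastic : {ae Pr, forall t, row_stochastic (P t)})
    (mu_stationary : {ae Pr, forall t, stationary_dist (P t) (mu t)}) :
  let S t := td_S gamma (P t) (mu t) in
  let A t := td_A (X t) (S t) in
  let y := labels X eps wstar in
  let w_TD t := td_est (X t) (S t) (y t) in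
  {ae Pr, forall t, A t \in unitmx} ->
  is_cond_exp_mx Pr (sigma_gen X) eps (fun=> 0) ->
  is_cond_cov Pr (sigma_gen X) eps C ->
  [/\ is_cond_exp_mx Pr (sigma_gen X) w_TD (fun=> wstar),
      is_cond_cov Pr (sigma_gen X) w_TD
        (fun t => invmx (A t) *m (X t)^T *m S t *m C t *m (S t)^T *m X t
                  *m (invmx (A t))^T)
    & {ae Pr, forall t, (S t)^T = S t} ->
      {ae Pr, forall t, S t \in unitmx} ->
      forall c : R, 0 < c ->
      {ae Pr, forall t, C t = c *: invmx (S t)} ->
      is_BLUE Pr X eps (fun t y => td_est (X t) (S t) y)].
Proof.
move=> S A y w_TD uA eps_mean eps_cov.
have subG := sigma_gen_measurable X_meas.
have aX := @adapted_sigma_gen _ _ _ _ _ X.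
have aS : adapted_mx (sigma_gen X) S.
  apply: measurable_mxM; first exact: measurable_diag_mx.
  by apply: measurable_mxB; [exact: measurable_mx_cst|exact: measurable_mxZ].
have aXT : adapted_mx (sigma_gen X) (fun t => (X t)^T).
  exact: measurable_mx_tr.
pose H t := invmx (A t) *m (X t)^T *m S t.
have aH : adapted_mx (sigma_gen X) H.
  apply: measurable_mxM => //; apply: measurable_mxM => //.
  by apply: measurable_invmx; do 2 apply: measurable_mxM => //.
have mlabels w : measurable_mx (labels X eps w).
  by apply: measurable_mxD => //; exact: measurable_mxM.
have estE t v : td_est (X t) (S t) v = H t *m v.
  by rewrite /td_est /td_b /H !mulmxA.
have mest w : measurable_mx (fun t => td_est (X t) (S t) (labels X eps w t)).
  under eq_fun do rewrite estE.
  by apply: measurable_mxM => //; exact: measurable_adapted_mx aH.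
(* The linear form [H v] holds everywhere, whereas [H X = 1] holds only where [A] is invertible. The
   parameter [w] is arbitrary because being BLUE concerns all parameters; [wstar] is one
   instance. *)
have est_affine w : {ae Pr, forall t,
    td_est (X t) (S t) (labels X eps w t) = w + H t *m eps t}.
  apply: filterS uA => t uAt; rewrite estE mulmxDr; congr (_ + _).
  by rewrite mulmxA [H t *m X t]td_left_inverse// mul1mx.
have est_unbiased w : is_cond_exp_mx Pr (sigma_gen X)
    (fun t => td_est (X t) (S t) (labels X eps w t)) (fun=> w).
  exact: is_cond_exp_affine (est_affine w).
have est_cov w : is_cond_cov Pr (sigma_gen X)
    (fun t => td_est (X t) (S t) (labels X eps w t))
    (fun t => H t *m C t *m (H t)^T).
  exact: is_cond_cov_affine (est_affine w).
split; first exact: est_unbiased.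
  have := est_cov wstar; congr is_cond_cov; apply/funext => t.
  by rewrite /H !trmx_mul trmxK !mulmxA.
move=> symS uS c c0 CE; split; [by exists H|exact: est_unbiased|].
move=> est' [M aM est'E] unb' w.
have {}est'E : est' = fun t v => M t *m v.
  by apply/funext => t; apply/funext => v.
rewrite {}est'E in unb' *.
have MX := unbiased_left_inverse subG eps_mean aX aM unb'.
(* Both covariances come from the affine form: an unbiased competitor also equals [w + M eps] almost
   surely, since [M X = 1]. *)
exists (fun t => M t *m C t *m (M t)^T), (fun t => H t *m C t *m (H t)^T).
split; [|exact: est_cov|].
  have aff : {ae Pr, forall t, M t *m labels X eps w t = w + M t *m eps t}.
    by apply: filterS MX => t MXt; rewrite mulmxDr mulmxA MXt mul1mx.
  apply: is_cond_cov_affine aff => //.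
  by apply: measurable_mxM => //; exact: measurable_adapted_mx aM.
(* The comparison is now pointwise, outside the union of the finitely many null sets excluded by the
   hypotheses and by [M X = 1]. *)
near=> t.
have St : (S t)^T = S t by near: t.
have uSt : S t \in unitmx by near: t.
have -> : C t = c *: invmx (S t) by near: t.
have stP : row_stochastic (P t) by near: t.
have stmu : stationary_dist (P t) (mu t) by near: t.
rewrite td_covariance_gap//; [|by near: t|by near: t].
apply/psd_mx_conj/psd_mx_scale_inv => // z.
exact: td_S_quadratic_form_ge0.
Unshelve. all: by end_near.
Qed.
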